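(* Let $(A,\le,0,1)$ be a bounded MLUB-complete poset, $(T,R)$ a time frame with $R$ serial, and $P,F,H,G$ the tense operators induced by $(T,R)$. Then for every $B\in(\mathcal P_+A)^T$ and $s\in T$: $P(\varphi(B))(s)=\operatorname{Min}U(\bigcup\{B(t)\mid tRs\})$, $F(\varphi(B))(s)=\operatorname{Min}U(\bigcup\{B(t)\mid sRt\})$, $H(\varphi(B))(s)=\operatorname{Max}L(\bigcup\{B(t)\mid tRs\})$, $G(\varphi(B))(s)=\operatorname{Max}L(\bigcup\{B(t)\mid sRt\})$.
   Context: For a poset and $X\subseteq A$: $L(X)$, $U(X)$ the sets of lower/upper bounds, $\operatorname{Max}X,\operatorname{Min}X$ the maximal/minimal elements. MLUB-complete: for every nonempty $M$, every upper bound of $M$ lies above a minimal upper bound and every lower bound below a maximal lower bound. $\mathcal P_+(X)$ = nonempty subsets. A time frame is $(T,R)$, $T\ne\emptyset$, $R\subseteq T^2$; serial: each $s$ has $r,t$ with $rRs$, $sRt$. The induced tense operators $P,F,H,G:\mathcal P_+(A^T)\to(\mathcal P_+A)^T$ are $P(C)(s)=\operatorname{Min}U(\{q(t)\mid q\in C,tRs\})$, $F(C)(s)=\operatorname{Min}U(\{q(t)\mid q\in C,sRt\})$, $H(C)(s)=\operatorname{Max}L(\{q(t)\mid q\in C,tRs\})$, $G(C)(s)=\operatorname{Max}L(\{q(t)\mid q\in C,sRt\})$. The transformation function is $\varphi:(\mathcal P_+A)^T\to\mathcal P_+(A^T)$, $\varphi(B)=\{q\in A^T\mid q(t)\in B(t)\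 \forall t\in T\}$. *)

(* Defs.v *)
From mathcomp Require Import all_boot all_order.
From mathcomp Require Import boolp classical_sets.
Set Implicit Arguments.
Unset Strict Implicit.
Unset Printing Implicit Defensive.
Import Order.TTheory.
Local Open Scope classical_set_scope.
Local Open Scope order_scope.

(* P_+(X) *)
Record nset (X : Type) : Type :=
  NSet { nset_val :> set X; nset_neq0 : nset_val !=set0 }.

Section Poset.
Context {d : Order.disp_t} {A : porderType d}.
Implicit Types X : set A.

Definition MinS X : set A := [set x | X x /\ forall y, X y -> y <= x -> y = x].
Definition MaxS X : set A := [set x | X x /\ forall y, X y -> x <= y -> y = x].

End Poset.

Definition mlub_complete (d : Order.disp_t) (A : porderType d) : Prop :=
  forall M : set A, M !=set0 ->
    (forall u, ubound M u -> exists2 m, MinS (ubound M) m & m <= u) /\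
    (forall l, lbound M l -> exists2 m, MaxS (lbound M) m & l <= m).

Definition serial (T : Type) (R : T -> T -> Prop) : Prop :=
  forall s, exists r t, R r s /\ R s t.

Section Tense.
Context {d : Order.disp_t} {A : tbPOrderType d} (hA : mlub_complete A).
Context {T : Type} {R : T -> T -> Prop} (hR : serial R).

Lemma MinU_neq0 (M : set A) : M !=set0 -> MinS (ubound M) !=set0.
Proof.
move=> M0; have [+ _] := hA M0.
by case/(_ \top) => [x _|m mM _]; [exact: lex1 | exists m].
Qed.

Lemma MaxL_neq0 (M : set A) : M !=set0 -> MaxS (lbound M) !=set0.
Proof.
move=> M0; have [_] := hA M0.
by case/(_ \bot) => [x _|m mM _]; [exact: le0x | exists m].
Qed.

Definition past_values (C : set (T -> A)) (s : T) : set A :=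
  [set q t | q in C & t in [set t | R t s]].

Definition future_values (C : set (T -> A)) (s : T) : set A :=
  [set q t | q in C & t in [set t | R s t]].

Lemma past_values_neq0 (C : nset (T -> A)) s : past_values C s !=set0.
Proof.
have [q Cq] := nset_neq0 C; have [r [t [rs _]]] := hR s.
by exists (q r), q => //; exists r.
Qed.

Lemma future_values_neq0 (C : nset (T -> A)) s : future_values C s !=set0.
Proof.
have [q Cq] := nset_neq0 C; have [r [t [_ st]]] := hR s.
by exists (q t), q => //; exists t.
Qed.

Definition tenseP (C : nset (T -> A)) : T -> nset A := fun s =>
  @NSet A (MinS (ubound (past_values C s))) (MinU_neq0 (past_values_neq0 C s)).

Definition tenseF (C : nset (T -> A)) : T -> nset A := fun s =>
  @NSet A (MinS (ubound (future_values C s)))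
    (MinU_neq0 (future_values_neq0 C s)).

Definition tenseH (C : nset (T -> A)) : T -> nset A := fun s =>
  @NSet A (MaxS (lbound (past_values C s))) (MaxL_neq0 (past_values_neq0 C s)).

Definition tenseG (C : nset (T -> A)) : T -> nset A := fun s =>
  @NSet A (MaxS (lbound (future_values C s)))
    (MaxL_neq0 (future_values_neq0 C s)).

End Tense.

Section Transformation.
Context {A T : Type}.

(* Nonemptiness is the axiom of choice. *)
Lemma selections_neq0 (B : T -> nset A) :
  [set q : T -> A | forall t, nset_val (B t) (q t)] !=set0.
Proof.
exists (fun t => projT1 (cid (nset_neq0 (B t)))) => t.
exact: (projT2 (cid (nset_neq0 (B t)))).
Qed.

Definition phi (B : T -> nset A) : nset (T -> A) :=
  @NSet (T -> A) [set q : T -> A | forall t, nset_val (B t) (q t)] (selections_neq0 B).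

End Transformation.

(* Main.v *)
Require Import Defs.
From mathcomp Require Import all_boot all_order.
From mathcomp Require Import boolp classical_sets functions.
Local Open Scope classical_set_scope.

(* The operators only see the values q(t) of the selections q in phi(B), and at
   each single instant t these exhaust B(t): any selection can be redefined at t
   to take a prescribed value of B(t). *)

Lemma image2_bigcupr (T1 T2 rT : Type) (f : T1 -> T2 -> rT)
    (X : set T1) (Y : set T2) :
  [set f x y | x in X & y in Y] = \bigcup_(y in Y) [set f x y | x in X].
Proof.
apply/seteqP; split=> [_ [x Xx [y Yy <-]]|_ [y Yy [x Xx <-]]].
  by exists y => //; exists x.
by exists x => //; exists y.
Qed.

Section PhiValues.
Context {A T : Type}.
Implicit Types (B : T -> nset A) (q r : T -> A) (D : set T).

Lemma phi_patch B q r D :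
  nset_val (phi B) q -> (forall t, D t -> nset_val (B t) (r t)) ->
  nset_val (phi B) (patch q D r).
Proof. by move=> phiBq BDr t; rewrite /patch; case: ifP => [/set_mem/BDr|]. Qed.

Lemma image_phi B t : [set q t | q in phi B] = B t.
Proof.
apply/seteqP; split=> [_ [q phiBq <-]|a Bta]; first exact: phiBq.
have [q phiBq] := nset_neq0 (phi B).
exists (patch q [set t] (fun=> a)); last by rewrite patchT ?inE.
by apply: phi_patch => // _ ->.
Qed.

Lemma image2_phi B D : [set q t | q in phi B & t in D] = \bigcup_(t in D) B t.
Proof.
by rewrite image2_bigcupr; apply: eq_bigcupr => t _; exact: image_phi.
Qed.

End PhiValues.

Section TenseValues.
Context {d : Order.disp_t} {A : tbPOrderType d}.
Context {T : Type} (R : T -> T -> Prop).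
Implicit Types (B : T -> nset A) (s : T).

Lemma past_values_phi B s :
  past_values (R := R) (phi B) s = \bigcup_(t in [set t | R t s]) B t.
Proof. exact: image2_phi. Qed.

Lemma future_values_phi B s :
  future_values (R := R) (phi B) s = \bigcup_(t in [set t | R s t]) B t.
Proof. exact: image2_phi. Qed.

End TenseValues.

Theorem theorem3p10 (d : Order.disp_t) (A : tbPOrderType d)
    (hA : mlub_complete A)
    (T : Type) (T_nonempty : inhabited T) (R : T -> T -> Prop)
    (hR : serial R) (B : T -> nset A) (s : T) :
  [/\ (tenseP hA hR (phi B) s : set A)
        = MinS (ubound (\bigcup_(t in [set t | R t s]) (B t : set A))),
      (tenseF hA hR (phi B) s : set A)
        = MinS (ubound (\bigcup_(t in [set t | R s t]) (B t : set A))),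
      (tenseH hA hR (phi B) s : set A)
        = MaxS (lbound (\bigcup_(t in [set t | R t s]) (B t : set A)))
    & (tenseG hA hR (phi B) s : set A)
        = MaxS (lbound (\bigcup_(t in [set t | R s t]) (B t : set A)))].
Proof. by split; rewrite /= (past_values_phi, future_values_phi). Qed.
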